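(* Let $k\ge2$ and let $H$ be a $k$-graph with $e_H\ge1$. Define $\Phi_H=\Phi_H(n,p)=\min\{\mathbb E X_J:\ J\subseteq H,\ e_J\ge1\}$. There are positive constants $c$, $C$, $D$ and $n_0$, all depending only on $H$, such that for all $n\ge n_0$, $p\in[0,1)$ and $\varepsilon\in[0,1]$ satisfying $\varepsilon^2\Phi_H\ge\mathbf 1_{\{\varepsilon<1\}}D$ we have $$\exp\{-(1-p)^{-5}C\varepsilon^2\Phi_H\}\ \le\ \mathbb P(X_H\le(1-\varepsilon)\mathbb E X_H)\ \le\ \exp\{-c\,\varepsilon^2\Phi_H\}.$$
   Context: A $k$-graph is a (finite) $k$-uniform hypergraph; isolated vertices are allowed. $e_H=|E(H)|$ and $v_H=|V(H)|$. $J\subseteq H$ means that $J$ is a (not necessarily induced) subgraph: $V(J)\subseteq V(H)$, $E(J)\subseteq E(H)$. $G^{(k)}_{n,p}$ is the random $k$-graph on $[n]=\{1,\dots,n\}$ in which each of the $\binom nk$ edges of the complete $k$-graph $K_n^{(k)}$ is included independently with probability $p$. For a $k$-graph $J$, $X_J=X_J(n,p)$ is the number of copies of $J$ in $G^{(k)}_{n,p}$, where a copy of $J$ is a subgraph isomorphic to $J$. $\mathbf 1_{\{A\}}$ equals $1$ if $A$ holds and $0$ otherwise. *)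

(* Defs.v *)
From HB Require Import structures.
From mathcomp Require Import all_boot all_order all_algebra.
From mathcomp Require Import reals.

Set Implicit Arguments.
Unset Strict Implicit.
Unset Printing Implicit Defensive.

Import Order.TTheory GRing.Theory Num.Theory.
Local Open Scope ring_scope.

Section KGraph.
Variables (k : nat) (T : finType).

Definition is_kgraph (G : {set T} * {set {set T}}) : bool :=
  [forall e in G.2, (e \subset G.1) && (#|e| == k)].

(* The vertex set is any subset of T, so that subgraphs and copies with fewer
   vertices live in the same type; isolated vertices are allowed. *)
Record kgraph := KGraph {
  kgraph_val :> {set T} * {set {set T}};
  kgraphP : is_kgraph kgraph_val
}.

HB.instance Definition _ := [isSub for kgraph_val].
HB.instance Definition _ := [Finite of kgraph by <:].

Definition vset (G : kgraph) : {set T} := (kgraph_val G).1.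
Definition eset (G : kgraph) : {set {set T}} := (kgraph_val G).2.

Definition subgraph (J H : kgraph) : bool :=
  (vset J \subset vset H) && (eset J \subset eset H).

End KGraph.

(* f is a total function, but only its restriction to vset J matters. Totality
   is a restriction only if T' is empty and T is not; then a J with a vertex has
   no isomorphic graph on T' anyway. *)
Definition isomorphic (k : nat) (T T' : finType)
    (J : kgraph k T) (J' : kgraph k T') : bool :=
  [exists f : {ffun T -> T'},
    [&& dinjectiveb f (mem (vset J)),
        f @: vset J == vset J'
      & [set f @: (e : {set T}) | e in eset J] == eset J']].

Definition copies (k : nat) (T T' : finType)
    (J : kgraph k T) (G : kgraph k T') : nat :=
  #|[set J' : kgraph k T' | subgraph J' G && isomorphic J J']|.

Section RandomKGraph.
Variables (R : realType) (k n : nat) (p : R).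

(* The product measure on the k-graphs with vertex set all of 'I_n. *)
Definition gnp_mass (G : kgraph k 'I_n) : R :=
  if vset G == [set: 'I_n] then
    \prod_(e : {set 'I_n} | #|e| == k) (if e \in eset G then p else 1 - p)
  else 0.

Definition gnp_prob (A : pred (kgraph k 'I_n)) : R :=
  \sum_(G | A G) gnp_mass G.

Definition gnp_mean (X : kgraph k 'I_n -> R) : R :=
  \sum_G gnp_mass G * X G.

Definition X_ (T : finType) (J : kgraph k T) (G : kgraph k 'I_n) : R :=
  (copies J G)%:R.

(* H itself is one of the J when it has an edge, so starting the minimum at
   the mean of X_ H does not change it. *)
Definition Phi (T : finType) (H : kgraph k T) : R :=
  \big[Num.min/gnp_mean (X_ H)]_(J : kgraph k T
      | subgraph J H && (1 <= #|eset J|)%N) gnp_mean (X_ J).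

End RandomKGraph.

Arguments X_ R {k} n {T} J G.
Arguments gnp_mean {R k n} p X.
Arguments gnp_prob {R k n} p A.
Arguments Phi {R k} n p {T} H.

(* Main.v *)
(** Everything rests on the Laplace transform L(s) = E exp(-s X_H). Janson's
    differential inequality L' <= -(mu - s Delta) L gives
    L(s) <= exp(-s mu + s^2 Delta / 2), and Delta <= 4^{e_H} mu^2 / Phi because
    the pairs of copies meeting in a copy of J contribute at most a constant
    times mu^2 / E X_J; Chernoff's bound then yields the upper bound.

    For the lower bound let J attain the minimum Phi and split X_H into pieces
    indexed by the copies of J, each piece vanishing unless its copy of J is
    present. Harris' inequality and Jensen's inequality, applied conditionally
    on the copy, give, with pi = p^{e_J} and x = s mu / Phi in [0, 1],
      L(s) >= (1 - pi + pi e^{-x})^{Phi / pi}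
           >= exp(-s mu + (1 - pi) x^2 Phi / 8).
    Taking x proportional to eps / (1 - p) and comparing L(s) with L(2 s) by the
    Cauchy-Schwarz inequality bounds the lower tail from below. When eps is
    large compared with 1 - p, the event X_J = 0 suffices. *)

Require Import Defs.
From HB Require Import structures.
From mathcomp Require Import all_boot all_order all_algebra all_fingroup.
From mathcomp Require Import reals ring lra.
From mathcomp.classical Require Import functions.
From mathcomp.analysis Require Import topology normedtype sequences exp derive realfun.

Set Implicit Arguments.
Unset Strict Implicit.
Unset Printing Implicit Defensive.

Import Order.TTheory GRing.Theory Num.Theory.
Import numFieldNormedType.Exports.
Local Open Scope ring_scope.

(** * Random subsets of a finite set *)

Section ProductMeasure.
Variables (R : realType) (U : finType) (q : U -> R).

Definition smass (S : {set U}) : R := \prod_u (if u \in S then q u else 1 - q u).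

Definition smean (f : {set U} -> R) : R := \sum_S smass S * f S.

Definition contains (F S : {set U}) : R := (F \subset S)%:R.

(** Conditional expectation given every element other than [u]. Averaging out the elements one at a
    time turns statements on [smean] into inductions. *)
Definition resample (u : U) (f : {set U} -> R) (S : {set U}) : R :=
  q u * f (u |: S) + (1 - q u) * f (S :\ u).

Definition decreasing (f : {set U} -> R) :=
  forall S S' : {set U}, S \subset S' -> f S' <= f S.

Definition increasing (f : {set U} -> R) :=
  forall S S' : {set U}, S \subset S' -> f S <= f S'.

Lemma eq_smean f g : f =1 g -> smean f = smean g.
Proof. by move=> fg; apply: eq_bigr => S _; rewrite fg. Qed.

Lemma smeanD f g : smean (fun S => f S + g S) = smean f + smean g.
Proof. by rewrite /smean -big_split; apply: eq_bigr => S _; rewrite mulrDr. Qed.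

Lemma smeanZ a f : smean (fun S => a * f S) = a * smean f.
Proof. by rewrite /smean mulr_sumr; apply: eq_bigr => S _; rewrite mulrCA. Qed.

Lemma smeanN f : smean (fun S => - f S) = - smean f.
Proof. by rewrite /smean -sumrN; apply: eq_bigr => S _; rewrite mulrN. Qed.

Lemma smeanB f g : smean (fun S => f S - g S) = smean f - smean g.
Proof. by rewrite smeanD smeanN. Qed.

Lemma smean_sum (I : finType) (P : pred I) (f : I -> {set U} -> R) :
  smean (fun S => \sum_(i | P i) f i S) = \sum_(i | P i) smean (f i).
Proof.
rewrite /smean exchange_big /=; apply: eq_bigr => S _.
by rewrite mulr_sumr.
Qed.

Lemma smean_cst a : smean (fun=> a) = a.
Proof.
rewrite /smean -mulr_suml.
have -> : \sum_S smass S = \prod_u (q u + (1 - q u)).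
  by rewrite (bigA_distr 1 _ q (fun u => 1 - q u)).
by rewrite big1 ?mul1r // => u _; rewrite subrKC.
Qed.

Lemma smean_resample u f : smean (resample u f) = smean f.
Proof.
(* Each set avoiding [u] is paired with its union with [u]; the two masses differ only in the factor
   at [u]. *)
have split_u (g : {set U} -> R) : smean g =
    \sum_(S : {set U} | u \notin S) (\prod_(v | v != u) (if v \in S then q v else 1 - q v)) *
      (q u * g (u |: S) + (1 - q u) * g S).
  rewrite /smean (bigID (fun S : {set U} => u \in S)) /=.
  rewrite (reindex_onto (fun S => u |: S) (fun S => S :\ u)) /=; last first.
    by move=> S uS; rewrite setD1K.
  rewrite (eq_bigl (fun S : {set U} => u \notin S)); last first.
    move=> S; rewrite setU11 /=; apply/eqP/idP => [<-|uS]; first by rewrite !inE eqxx.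
    by rewrite setU1K.
  rewrite -big_split /=; apply: eq_bigr => S uS.
  rewrite /smass !(bigD1 (P := predT) u) //= setU11 (negbTE uS).
  rewrite (eq_bigr (fun v => if v \in S then q v else 1 - q v)); first by ring.
  by move=> v vu; rewrite !inE (negbTE vu).
rewrite !split_u; apply: eq_bigr => S uS.
rewrite /resample setUA setUid setU1K //.
have -> : S :\ u = S.
  by apply/setP => v; rewrite !inE; case: eqP => // ->; rewrite (negbTE uS).
by congr (_ * _); ring.
Qed.

Hypothesis q01 : forall u, 0 <= q u <= 1.

Lemma smass_ge0 S : 0 <= smass S.
Proof.
apply: prodr_ge0 => u _; have /andP[q0 q1] := q01 u.
by case: ifP; rewrite ?subr_ge0.
Qed.

Lemma ler_smean f g : (forall S, f S <= g S) -> smean f <= smean g.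
Proof.
by move=> fg; apply: ler_sum => S _; apply: ler_wpM2l (fg S); apply: smass_ge0.
Qed.

Lemma smean_ge0 f : (forall S, 0 <= f S) -> 0 <= smean f.
Proof. by move=> f0; apply: sumr_ge0 => S _; rewrite mulr_ge0 ?smass_ge0. Qed.

Let resamples (r : seq U) f := foldr resample f r.

Let resample_decreasing u f : decreasing f -> decreasing (resample u f).
Proof.
move=> df S S' SS'; have /andP[q0 q1] := q01 u; rewrite /resample.
apply: lerD; apply: ler_wpM2l; rewrite ?subr_ge0 //; apply: df.
  exact: setUS.
exact: setSD.
Qed.

Let resamples_decreasing r f : decreasing f -> decreasing (resamples r f).
Proof. by move=> df; elim: r => //= u r IHr; apply: resample_decreasing. Qed.

(** Induction on the averaged elements. One step is Chebyshev's inequality on two points: the sides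
    differ by [q u * (1 - q u)] times a product of two nonnegative decrements. *)
Let resamples_harris r f g : decreasing f -> decreasing g -> forall S,
  resamples r f S * resamples r g S <= resamples r (fun S => f S * g S) S.
Proof.
move=> df dg; elim: r => //= u r IHr S.
have /andP[q0 q1] := q01 u; rewrite {1 2}/resample.
have SS : S :\ u \subset u |: S.
  by apply: subset_trans (subsetUr _ _); apply: subsetDl.
have dF := resamples_decreasing r df SS; have dG := resamples_decreasing r dg SS.
rewrite {1}/resample.
apply: le_trans (lerD (ler_wpM2l q0 (IHr _)) (ler_wpM2l _ (IHr _))); last first.
  by rewrite subr_ge0.
rewrite -subr_ge0.
set F1 := resamples r f (u |: S) in dF *; set F0 := resamples r f (S :\ u) in dF *.
set G1 := resamples r g (u |: S) in dG *; set G0 := resamples r g (S :\ u) in dG *.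
have -> : q u * (F1 * G1) + (1 - q u) * (F0 * G0) -
   (q u * F1 + (1 - q u) * F0) * (q u * G1 + (1 - q u) * G0) =
   q u * (1 - q u) * ((F0 - F1) * (G0 - G1)) by ring.
by rewrite !mulr_ge0 ?subr_ge0.
Qed.

Let resamples_local r f (S S' : {set U}) :
  (forall u, u \notin r -> (u \in S) = (u \in S')) -> resamples r f S = resamples r f S'.
Proof.
elim: r S S' => [|u r IHr] S S' SS' /=; first by congr f; apply/setP => u; apply: SS'.
rewrite /resample; congr (_ * _ + _ * _); apply: IHr => v vr; rewrite !inE;
  by case: eqVneq => //= vu; apply: SS'; rewrite inE negb_or vu.
Qed.

(** Averaging out every element preserves the mean and leaves a constant function, so its value at
    [set0] is the mean. *)
Let smean_resamples f : smean f = resamples (enum U) f set0.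
Proof.
have -> : smean f = smean (resamples (enum U) f).
  by elim: (enum U) => //= u r IHr; rewrite smean_resample.
rewrite -[RHS]smean_cst; apply: eq_smean => S; apply: resamples_local => u.
by rewrite mem_enum.
Qed.

Lemma harris f g : decreasing f -> decreasing g ->
  smean f * smean g <= smean (fun S => f S * g S).
Proof. by move=> df dg; rewrite !smean_resamples; apply: resamples_harris. Qed.

Lemma harris_incr_decr f g : increasing f -> decreasing g ->
  smean (fun S => f S * g S) <= smean f * smean g.
Proof.
move=> df dg; rewrite -lerN2 -mulNr -!smeanN.
apply: le_trans (harris _ dg) _; first by move=> S S' SS'; rewrite lerN2 df.
by rewrite le_eqVlt (eq_smean (g := fun S => - (f S * g S))) ?eqxx // => S; rewrite mulNr.
Qed.

(** Nonnegativity of the factors keeps every partial product decreasing, so [harris] can be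
    iterated. *)
Lemma harris_prod (I : finType) (P : pred I) (f : I -> {set U} -> R) :
  (forall i S, 0 <= f i S) -> (forall i, decreasing (f i)) ->
  \prod_(i | P i) smean (f i) <= smean (fun S => \prod_(i | P i) f i S).
Proof.
move=> f0 df; rewrite -big_filter.
rewrite [leRHS](eq_smean (g := fun S => \prod_(i <- [seq i <- index_enum I | P i]) f i S)).
  2: by move=> S; rewrite big_filter.
elim: [seq i <- _ | _] => [|i r IHr].
  by rewrite big_nil (eq_smean (g := fun=> 1)) ?smean_cst // => S; rewrite big_nil.
rewrite big_cons [leRHS](eq_smean
  (g := fun S => f i S * \prod_(j <- r) f j S)); last by move=> S; rewrite big_cons.
apply: le_trans (harris _ _) => //.
  by apply: ler_wpM2l => //; apply: smean_ge0.
move=> S S' SS'; apply: ler_prod => j _; by rewrite f0 df.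
Qed.

Lemma contains_ge0 F S : 0 <= contains F S.
Proof. by rewrite ler0n. Qed.

Lemma contains_le1 F S : contains F S <= 1.
Proof. by rewrite lern1 leq_b1. Qed.

Lemma contains_increasing F : increasing (contains F).
Proof.
move=> S S' SS'; rewrite ler_nat; case: (boolP (F \subset S)) => // FS.
by rewrite (subset_trans FS SS').
Qed.

Lemma containsU F F' S : contains (F :|: F') S = contains F S * contains F' S.
Proof. by rewrite /contains subUset -natrM mulnb. Qed.

(** Independence: the hypothesis says that [f] ignores the elements of [F]. Resampling an element
    [u] of [F] yields the factor [q u], because the indicator vanishes once [u] is removed. *)
Lemma smean_containsM F f : (forall S, f (S :\: F) = f S) ->
  smean (fun S => contains F S * f S) = (\prod_(u in F) q u) * smean f.
Proof.
have [m] := ubnP #|F|; elim: m F f => // m IHm F f.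
have [-> _ _|[u uF'] Fm locf] := set_0Vmem F.
  rewrite big_set0 mul1r; apply: eq_smean => S.
  by rewrite /contains sub0set mul1r.
move: Fm locf; rewrite -(setD1K uF'); set F' := F :\ u => Fm locf.
have {uF'} uF : u \notin F' by rewrite !inE eqxx.
move: F' uF Fm locf => {}F uF; rewrite cardsU1 uF ltnS => Fm locf.
rewrite big_setU1 //= -mulrA -(IHm F) //; last first.
  by move=> S; rewrite -locf setDDl setUCA setUid locf.
rewrite -smeanZ -(smean_resample u); apply: eq_smean => S.
rewrite /resample /contains !subUset !sub1set !inE eqxx /= mul0r mulr0 addr0.
have -> : (F \subset u |: S) = (F \subset S).
  apply/idP/idP => [|/subset_trans->//].
    move=> /subsetP FS; apply/subsetP => v vF; have := FS v vF.
    by rewrite !inE; case: eqP vF uF => [->->|].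
  by apply/subsetP => v vS; rewrite !inE vS; case: eqP.
by congr (_ * (_ * _)); rewrite -locf -[RHS]locf; congr f; apply/setP => v;
  rewrite !inE; case: eqP.
Qed.

Lemma smean_contains F : smean (contains F) = \prod_(u in F) q u.
Proof.
have := @smean_containsM F (fun=> 1); rewrite smean_cst mulr1 => <- //.
by apply: eq_smean => S; rewrite mulr1.
Qed.

End ProductMeasure.

(** * Termwise differentiation of Laplace transforms *)

Lemma is_derive_sum_seq (R : realType) (I : Type) (r : seq I)
    (h dh : I -> R -> R) (x : R) :
  (forall i, is_derive x 1 (h i) (dh i x)) ->
  is_derive x 1 (fun y => \sum_(i <- r) h i y) (\sum_(i <- r) dh i x).
Proof.
move=> dhx; elim: r => [|i r IHr].
  rewrite big_nil; apply: is_derive_eq; last by [].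
  by under boolp.eq_fun do rewrite big_nil; apply: is_derive_cst.
rewrite big_cons; under boolp.eq_fun do rewrite big_cons.
exact: is_deriveD.
Qed.

Lemma is_derive_gauss (R : realType) (m a b x : R) :
  is_derive x 1 (fun y : R => m * expR (y * a - y ^+ 2 * b))
    (m * (expR (x * a - x ^+ 2 * b) * (a - 2 * x * b))).
Proof.
have df : is_derive x 1 (fun y : R => y * a - y ^+ 2 * b) (a - 2 * x * b).
  have -> : (fun y : R => y * a - y ^+ 2 * b) = a *: (@id R) - b *: ((@id R) ^+ 2).
    apply: boolp.funext => y; rewrite /= !fctE.
    by rewrite /GRing.scale /= mulrC [b * _]mulrC.
  by apply: is_derive_eq; rewrite /GRing.scale /=; ring.
by have := is_deriveZ m (is_derive1_comp (is_derive_expR _) df).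
Qed.

(** * Laplace transforms of counting variables *)

Section Janson.
Variables (R : realType) (U : finType) (q : U -> R).
Hypothesis q01 : forall u, 0 <= q u <= 1.
Variables (A : finType) (E : A -> {set U}) (kappa : R).
Hypothesis kappa0 : 0 <= kappa.

(** The weight [kappa] corrects a multiplicity: copies will be indexed by permutations, each copy
    occurring equally often. *)
Definition wcount (S : {set U}) : R := kappa * \sum_a contains R (E a) S.

Definition laplace (s : R) : R := smean q (fun S => expR (- s * wcount S)).

(** Janson's $\Delta$, taken over ordered pairs and including [a = b] when [E a] is nonempty. *)
Definition overlap : R := kappa ^+ 2 *
  \sum_a \sum_(b | ~~ [disjoint E a & E b]) smean q (contains R (E a :|: E b)).

Local Notation mu := (smean q wcount).

Lemma wcount_ge0 S : 0 <= wcount S.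
Proof. by rewrite mulr_ge0 // sumr_ge0 // => a _; apply: contains_ge0. Qed.

Lemma laplace_gt0 s : 0 < laplace s.
Proof.
(* The masses sum to 1, so one of them is positive. *)
have [S mS] : exists S, 0 < smass q S.
  apply/existsP; apply: contraT => /existsPn nex.
  have : smean q (fun=> 1) <= smean q (fun=> 0).
    apply: ler_sum => S _; rewrite mulr1 mulr0 leNgt; exact: nex.
  by rewrite !smean_cst ler10.
rewrite /laplace /smean (bigD1 S) //=; apply: ltr_wpDr.
  by apply: sumr_ge0 => S' _; rewrite mulr_ge0 ?smass_ge0 ?expR_ge0.
by rewrite mulr_gt0 ?expR_gt0.
Qed.

Let near_count a S := kappa * \sum_(b | ~~ [disjoint E a & E b]) contains R (E b) S.
Let far_count a S := kappa * \sum_(b | [disjoint E a & E b]) contains R (E b) S.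

Let count_split a S : wcount S = near_count a S + far_count a S.
Proof.
by rewrite /wcount (bigID (fun b => [disjoint E a & E b])) mulrDr addrC.
Qed.

Let wsum_increasing (P : pred A) :
  increasing (fun S => kappa * \sum_(b | P b) contains R (E b) S).
Proof.
move=> S S' SS'; apply: ler_wpM2l => //; apply: ler_sum => b _.
exact: contains_increasing.
Qed.

Let expR_decreasing s (f : {set U} -> R) : 0 <= s -> increasing f ->
  decreasing (fun S => expR (- s * f S)).
Proof.
by move=> s0 incf S S' SS'; rewrite ler_expR !mulNr lerN2 ler_wpM2l ?incf.
Qed.

(* Conditioning on one indicator costs at most the overlapping terms: the
   disjoint terms are independent of it, and Harris handles the cross term. *)
Let laplace_contains a s : 0 <= s ->
  (smean q (contains R (E a)) - s * smean q (fun S => contains R (E a) S * near_count a S))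
    * laplace s <= smean q (fun S => contains R (E a) S * expR (- s * wcount S)).
Proof.
move=> s0; set Da := smean q (fun S => _ * near_count a S).
set Pa := smean q (contains R (E a)).
have rhs0 : 0 <= smean q (fun S => contains R (E a) S * expR (- s * wcount S)).
  by apply: smean_ge0 => // S; rewrite mulr_ge0 ?contains_ge0 ?expR_ge0.
have [c0|c0] := leP 0 (Pa - s * Da); last first.
  apply: le_trans rhs0; rewrite nmulr_rle0 //; exact/ltW/laplace_gt0.
(* [M] dominates [laplace s], since the terms meeting [E a] only increase the count. *)
pose M := smean q (fun S => expR (- s * far_count a S)).
apply: (@le_trans _ _ ((Pa - s * Da) * M)).
  apply: ler_wpM2l => //; apply: ler_smean => // S.
  rewrite ler_expR (count_split a) mulrDr gerDr mulNr oppr_le0 mulr_ge0 //.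
  by rewrite mulr_ge0 // sumr_ge0 // => b _; apply: contains_ge0.
have PM : smean q (fun S => contains R (E a) S * expR (- s * far_count a S)) = Pa * M.
  rewrite smean_containsM -?smean_contains // => S; congr (expR (_ * (_ * _))).
  apply: eq_bigr => b /pred0P dis; rewrite /contains; congr (nat_of_bool _)%:R.
  apply/subsetP/subsetP => sub u ub; first by have := sub u ub; rewrite inE => /andP[].
  by rewrite inE sub // andbT; apply/negP => ua; have := dis u; rewrite /= ua ub.
have DM : smean q (fun S => (contains R (E a) S * near_count a S) *
    expR (- s * far_count a S)) <= Da * M.
  apply: harris_incr_decr => //; last by apply: expR_decreasing => //; apply: wsum_increasing.
  move=> S S' SS'; apply: ler_pM.
  - exact: contains_ge0.
  - by rewrite mulr_ge0 // sumr_ge0 // => b _; apply: contains_ge0.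
  - exact: contains_increasing.
  - exact: wsum_increasing.
rewrite mulrBl -mulrA.
apply: le_trans (lerB (lexx _) (ler_wpM2l s0 DM)) _; rewrite -PM -smeanZ -smeanB.
(* Pointwise this is [1 - s * Y <= expR (- s * Y)] with [Y] the near count. *)
apply: ler_smean => // S; rewrite (count_split a) mulrDr expRD.
set I := contains R (E a) S; set Y := near_count a S; set e := expR (- s * far_count a S).
have -> : I * e - s * (I * Y * e) = I * ((1 + - s * Y) * e) by ring.
by rewrite ler_wpM2l ?contains_ge0 // ler_wpM2r ?expR_ge0 // expR_ge1Dx.
Qed.

(** The right side is $-L'(s)$: this is Janson's differential inequality, summed from
    [laplace_contains]. *)
Let laplace_deriv_bound s : 0 <= s ->
  (mu - s * overlap) * laplace s <= smean q (fun S => wcount S * expR (- s * wcount S)).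
Proof.
move=> s0.
have -> : smean q (fun S => wcount S * expR (- s * wcount S)) =
    kappa * \sum_a smean q (fun S => contains R (E a) S * expR (- s * wcount S)).
  rewrite -smean_sum -smeanZ; apply: eq_smean => S.
  by rewrite {1}/wcount -mulrA mulr_suml.
have -> : mu - s * overlap = kappa * \sum_a (smean q (contains R (E a)) -
    s * smean q (fun S => contains R (E a) S * near_count a S)).
  rewrite sumrB mulrBr; congr (_ - _).
    by rewrite /wcount smeanZ smean_sum.
  rewrite -mulr_sumr [RHS]mulrCA; congr (_ * _).
  rewrite /overlap expr2 -mulrA; congr (_ * _); rewrite mulr_sumr.
  apply: eq_bigr => a _; rewrite -smean_sum -smeanZ.
  apply: eq_smean => S; rewrite [RHS]mulrCA [in RHS]mulr_sumr; congr (_ * _).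
  by apply: eq_bigr => b _; rewrite containsU.
rewrite -mulrA ler_wpM2l // mulr_suml; apply: ler_sum => a _.
exact: laplace_contains.
Qed.

(** By the differential inequality, $L(x)\exp(x\mu-x^2\Delta/2)$ is nonincreasing for $x\ge0$, and
    it equals 1 at $x=0$. *)
Lemma laplace_le s : 0 <= s -> laplace s <= expR (- s * mu + s ^+ 2 * overlap / 2).
Proof.
move=> s0.
pose c x : R := x * mu - x ^+ 2 * (overlap / 2).
pose h S x : R := smass q S * expR (x * (mu - wcount S) - x ^+ 2 * (overlap / 2)).
pose dh S x : R := smass q S * (expR (x * (mu - wcount S) - x ^+ 2 * (overlap / 2)) *
  (mu - wcount S - 2 * x * (overlap / 2))).
have dg (x : R) := @is_derive_sum_seq R _ (index_enum _) h dh x (fun S => is_derive_gauss _ _ _ x).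
set g := (fun y => _) in dg.
have hE (S : {set U}) (x : R) : expR (x * (mu - wcount S) - x ^+ 2 * (overlap / 2)) =
    expR (- x * wcount S) * expR (c x).
  by rewrite /c -expRD; congr expR; ring.
have gE x : g x = laplace x * expR (c x).
  rewrite /laplace /smean mulr_suml; apply: eq_bigr => S _.
  by rewrite /h hE mulrA.
have : g s <= g 0.
  apply: (@ler0_derive1_nincr _ g 0 s) => //.
  - move=> x; rewrite in_itv /= => /andP[x0 _].
    rewrite derive1E (@derive_val _ _ _ _ _ _ _ (dg x)).
    have -> : \sum_(S <- index_enum _) dh S x = expR (c x) *
       ((mu - x * overlap) * laplace x - smean q (fun S => wcount S * expR (- x * wcount S))).
      rewrite mulrBr /laplace /smean !mulr_sumr -sumrB; apply: eq_bigr => S _.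
      by rewrite /dh hE -[\sum_S0 _]/(smean q wcount); field.
    by rewrite pmulr_rle0 ?expR_gt0 // subr_le0 laplace_deriv_bound // ltW.
  - apply: continuous_subspaceT => x; apply: differentiable_continuous.
    by apply/derivable1_diffP; have [] := dg x.
rewrite !gE /c !mul0r expr0n /= mul0r subrr expR0 mulr1.
have -> : laplace 0 = 1.
  by rewrite /laplace -[RHS](smean_cst q); apply: eq_smean => S; rewrite oppr0 mul0r expR0.
rewrite -ler_pdivlMr ?expR_gt0 // mul1r -expRN.
by congr (_ <= expR _); ring.
Qed.

End Janson.

(** * Elementary exponential inequalities *)

(** Multiplied by [expR (pi * x)], the right side is the exponential moment of a centred two-point
    variable. In the quadratic lower bounds the linear terms cancel, which leaves $1+2u\ge e^u$ with
    $u=\pi(1-\pi)x^2/8$. *)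
Lemma bernoulli_laplace (R : realType) (pi x : R) : 0 <= pi <= 1 -> 0 <= x <= 1 ->
  expR (- pi * x + pi * (1 - pi) * x ^+ 2 / 8) <= 1 - pi + pi * expR (- x).
Proof.
move=> /andP[pi0 pi1] /andP[x0 x1].
(* [expR y >= (1 + y / 2) ^+ 2] keeps a quadratic term of the exponential series *)
have sq (y : R) : -2 <= y -> (1 + y / 2) ^+ 2 <= expR y.
  move=> y2; have -> : expR y = expR (y / 2) ^+ 2.
    by rewrite expr2 -expRD; congr expR; field.
  by rewrite ler_sqr ?nnegrE ?expR_ge0 ?expR_ge1Dx //; lra.
have pix : 0 <= pi * x <= 1 by rewrite mulr_ge0 // mulr_ile1.
set u := pi * (1 - pi) * x ^+ 2 / 8.
have pi2 : 0 <= pi * (1 - pi) <= 1 by apply/andP; split; nra.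
have u01 : 0 <= u <= 1 / 2.
  have /andP[v0 v1] : 0 <= pi * (1 - pi) * x ^+ 2 <= 1.
    move/andP: pi2 => [a0 a1].
    by rewrite mulr_ge0 ?sqr_ge0 //= mulr_ile1 ?sqr_ge0 // expr_le1.
  by rewrite /u; apply/andP; split; lra.
(* Through $e^u\le1/(1-u)\le1+2u$, valid for $0\le u\le1/2$. *)
have eu : expR u <= 1 + 2 * u.
  have u1 : 0 < 1 - u by lra.
  rewrite -(ler_pM2r u1); apply: le_trans (_ : 1 <= _); last by nra.
  by rewrite -[leRHS](expRxMexpNx_1 u) ler_pM2l ?expR_gt0 // expR_ge1Dx.
have s1 : (1 + pi * x / 2) ^+ 2 <= expR (pi * x) by apply: sq; lra.
have s2 : (1 + (pi * x - x) / 2) ^+ 2 <= expR (pi * x - x) by apply: sq; lra.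
rewrite mulNr addrC expRD (expRN (pi * x)) ler_pdivrMr ?expR_gt0 //.
apply: (le_trans eu); rewrite [leRHS]mulrDl -mulrA -expRD [- x + _]addrC.
have m1 : (1 - pi) * (1 + pi * x / 2) ^+ 2 <= (1 - pi) * expR (pi * x).
  by rewrite ler_wpM2l // subr_ge0.
have m2 : pi * (1 + (pi * x - x) / 2) ^+ 2 <= pi * expR (pi * x - x).
  by rewrite ler_wpM2l.
apply: le_trans (lerD m1 m2); rewrite le_eqVlt; apply/orP; left; apply/eqP.
by rewrite /u; field.
Qed.

(** After taking reciprocals, this is $1+y\le e^y$ at $y=\pi/(1-\pi)$. *)
Lemma expR_geom_le (R : realType) (pi : R) : 0 <= pi < 1 ->
  expR (- (pi / (1 - pi))) <= 1 - pi.
Proof.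
move=> /andP[pi0 pi1]; have q0 : 0 < 1 - pi by rewrite subr_gt0.
rewrite expRN -[leRHS]invrK lef_pV2 ?posrE ?expR_gt0 ?invr_gt0 //.
apply: le_trans (expR_ge1Dx _); rewrite le_eqVlt; apply/orP; left; apply/eqP.
by field; rewrite gt_eqF.
Qed.

(** * Tail bounds *)

Section Tails.
Variables (R : realType) (U : finType) (q : U -> R).
Hypothesis q01 : forall u, 0 <= q u <= 1.
Variables (A : finType) (E : A -> {set U}) (kappa : R).
Hypothesis kappa0 : 0 <= kappa.

Local Notation X := (wcount E kappa).
Local Notation mu := (smean q X).
Local Notation L := (laplace q E kappa).

Definition lower_tail (t : R) : R := smean q (fun S => (X S <= t)%R%:R).

Lemma lower_tail_le1 t : lower_tail t <= 1.
Proof.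
by rewrite -[leRHS](smean_cst q); apply: ler_smean => // S; rewrite lern1 leq_b1.
Qed.

(** Chernoff's bound; for [Phi > 0] the chosen [s] minimises
    $-s\varepsilon\mu+s^2K\mu^2/(2\Phi)$. *)
Lemma lower_tail_le (eps Phi K : R) : 0 <= eps -> 0 <= Phi -> 0 < K -> 0 < mu ->
  overlap q E kappa * Phi <= K * mu ^+ 2 ->
  lower_tail ((1 - eps) * mu) <= expR (- (eps ^+ 2 * Phi / (2 * K))).
Proof.
move=> eps0 Phi0 K0 mu0 DPhi; pose s := eps * Phi / (K * mu).
have s0 : 0 <= s by rewrite divr_ge0 ?mulr_ge0 // ltW // mulr_gt0.
have -> : lower_tail ((1 - eps) * mu) = expR (s * ((1 - eps) * mu)) *
    (expR (- (s * ((1 - eps) * mu))) * lower_tail ((1 - eps) * mu)).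
  by rewrite mulrA -expRD subrr expR0 mul1r.
apply: le_trans (_ : expR (s * ((1 - eps) * mu)) * L s <= _).
  rewrite ler_wpM2l ?expR_ge0 // -smeanZ; apply: ler_smean => // S.
  have [Xle|_] := leP (X S) _; last by rewrite mulr0 expR_ge0.
  by rewrite mulr1 ler_expR mulNr lerN2 ler_wpM2l.
apply: le_trans (ler_wpM2l (expR_ge0 _) (laplace_le q01 E kappa0 s0)) _.
rewrite -expRD ler_expR.
have sD : s ^+ 2 * overlap q E kappa <= eps ^+ 2 * Phi / K.
  have -> : s ^+ 2 * overlap q E kappa =
      eps ^+ 2 * Phi / (K ^+ 2 * mu ^+ 2) * (overlap q E kappa * Phi).
    by rewrite /s; field; rewrite !gt_eqF.
  have -> : eps ^+ 2 * Phi / K = eps ^+ 2 * Phi / (K ^+ 2 * mu ^+ 2) * (K * mu ^+ 2).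
    by field; rewrite !gt_eqF.
  by rewrite ler_wpM2l // divr_ge0 ?mulr_ge0 ?sqr_ge0 ?exprn_ge0 // ltW.
have sm : s * mu = eps * Phi / K by rewrite /s; field; rewrite !gt_eqF.
have -> : s * ((1 - eps) * mu) + (- s * mu + s ^+ 2 * overlap q E kappa / 2) =
   - eps * (s * mu) + s ^+ 2 * overlap q E kappa / 2 by ring.
have -> : - (eps ^+ 2 * Phi / (2 * K)) = - eps * (s * mu) + eps ^+ 2 * Phi / K / 2.
  by rewrite sm; field; rewrite gt_eqF.
by rewrite lerD2l ler_pM2r ?invr_gt0.
Qed.

(* Paley-Zygmund for the exponentially tilted measure. *)
Lemma lower_tail_ge_laplace (s t : R) : 0 <= s -> expR (- s * t) <= L s / 2 ->
  L s ^+ 2 / (4 * L (2 * s)) <= lower_tail t.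
Proof.
move=> s0 Lhalf; pose m := smean q (fun S => expR (- s * X S) * (X S <= t)%R%:R).
have L0 := laplace_gt0 q01 E kappa s; have L20 := laplace_gt0 q01 E kappa (2 * s).
(* Where [X S > t] the integrand is at most [expR (- s * t)], so at most half of [L s] is lost. *)
have mL : L s / 2 <= m.
  suff : L s <= expR (- s * t) + m by lra.
  rewrite -(smean_cst q (expR _)) -smeanD; apply: ler_smean => // S.
  have [Xle|Xgt] := leP (X S) t; first by rewrite mulr1 lerDr expR_ge0.
  by rewrite mulr0 addr0 ler_expR !mulNr lerN2 ler_wpM2l // ltW.
have cs : m ^+ 2 / L (2 * s) <= lower_tail t.
  (* Cauchy-Schwarz by expanding a square; this [l] minimises the resulting quadratic. *)
  pose l := m / L (2 * s).
  have : 0 <= smean q (fun S => (l * expR (- s * X S) - (X S <= t)%R%:R) ^+ 2).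
    by apply: smean_ge0 => // S; apply: sqr_ge0.
  rewrite (eq_smean _ (g := fun S => l ^+ 2 * expR (- (2 * s) * X S) -
     2 * l * (expR (- s * X S) * (X S <= t)%R%:R) + (X S <= t)%R%:R)); last first.
    move=> S; have -> : expR (- (2 * s) * X S) = expR (- s * X S) ^+ 2.
      by rewrite expr2 -expRD; congr expR; ring.
    by case: (X S <= t) => /=; ring.
  rewrite smeanD smeanB !smeanZ -/m -/(L (2 * s)) -/(lower_tail t).
  have -> : l ^+ 2 * L (2 * s) - 2 * l * m = - (m ^+ 2 / L (2 * s)).
    by rewrite /l; field; rewrite gt_eqF.
  by rewrite addrC subr_ge0.
apply: le_trans cs.
have -> : L s ^+ 2 / (4 * L (2 * s)) = (L s / 2) ^+ 2 / L (2 * s).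
  by field; rewrite gt_eqF.
rewrite ler_wpM2r ?invr_ge0 ?(ltW L20) // ler_sqr ?nnegrE //.
  by rewrite divr_ge0 // ltW.
by apply: le_trans mL; rewrite divr_ge0 // ltW.
Qed.

Variables (B : finType) (P : pred B) (F : B -> {set U}) (beta : A -> B) (pi nu : R).
Hypothesis Pbeta : forall a, P (beta a).
Hypothesis Fbeta : forall a, F (beta a) \subset E a.
Hypothesis pr_F : forall b, P b -> smean q (contains R (F b)) = pi.
Hypothesis pr_fiber : forall b, P b ->
  kappa * \sum_(a | beta a == b) smean q (contains R (E a)) = pi * nu.

(** A piece vanishes unless [F b] is present and has mean [pi * nu], so for [pi > 0] the number [nu]
    is its conditional mean given [F b]. *)
Let part b S := kappa * \sum_(a | beta a == b) contains R (E a) S.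

Let count_parts S : X S = \sum_(b | P b) part b S.
Proof.
by rewrite /wcount (partition_big beta P) //= mulr_sumr; apply: eq_bigr.
Qed.

(* The pieces are decreasing functions, so Harris bounds the Laplace transform
   below by a product; each piece vanishes unless F b is present. *)
Lemma laplace_ge (s : R) : 0 <= s ->
  (1 - pi + pi * expR (- (s * nu))) ^+ #|P| <= L s.
Proof.
move=> s0; rewrite -prodr_const.
apply: le_trans (_ : \prod_(b | P b) smean q (fun S => expR (- s * part b S)) <= _);
    last first.
  have h := @harris_prod R U q q01 B P (fun b S => expR (- s * part b S)).
  apply: le_trans (h _ _) _ => [b S|b S S' SS'|]; first exact: expR_ge0.
    rewrite ler_expR !mulNr lerN2 ler_wpM2l // ler_wpM2l //.
    by apply: ler_sum => a _; apply: contains_increasing.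
  by apply: ler_smean => // S; rewrite count_parts mulr_sumr expR_sum.
apply: ler_prod => b Pb.
have e0 := expR_ge0 (- (s * nu)).
(* Jensen's inequality through a tangent line: given [F b], $e^{s\nu-sY}\ge1+s\nu-sY$ for the piece
   $Y$, and the right side has conditional mean 1. Without [F b] both integrands are 1. *)
have -> : 1 - pi + pi * expR (- (s * nu)) = smean q (fun S => 1 - contains R (F b) S +
    expR (- (s * nu)) * ((1 + s * nu) * contains R (F b) S - s * part b S)).
  rewrite smeanD smeanB smean_cst smeanZ smeanB !smeanZ smean_sum pr_F // pr_fiber //.
  by ring.
have pi1 : pi <= 1.
  rewrite -(pr_F Pb) -[leRHS](smean_cst q).
  by apply: ler_smean => // S; apply: contains_le1.
have pi0 : 0 <= pi.
  by rewrite -(pr_F Pb); apply: smean_ge0 => // S; apply: contains_ge0.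
apply/andP; split.
  rewrite smeanD smeanB smean_cst smeanZ smeanB !smeanZ smean_sum pr_F // pr_fiber //.
  rewrite addr_ge0 ?subr_ge0 //.
  have -> : (1 + s * nu) * pi - s * (pi * nu) = pi by ring.
  by rewrite mulr_ge0.
apply: ler_smean => // S; rewrite {1 2}/contains.
have [FS|FS] := boolP (F b \subset S); last first.
  have -> : part b S = 0.
    rewrite /part big1 ?mulr0 // => a /eqP ab; rewrite /contains.
    by case: (boolP (E a \subset S)) => // ES; case/negP: FS; rewrite -ab (subset_trans (Fbeta a)).
  by rewrite !mulr0 subr0 subrr mulr0 addr0 expR0.
rewrite mulr1 subrr add0r -addrA.
apply: le_trans (ler_wpM2l e0 (expR_ge1Dx (s * nu - s * part b S))) _.
by rewrite -expRD addKr mulNr.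
Qed.

(** If no [F b] is present then [X] vanishes, and by Harris' inequality this is at least as likely
    as for independent events. *)
Lemma lower_tail_ge_void (t : R) : 0 <= t -> 0 <= pi <= 1 ->
  (1 - pi) ^+ #|P| <= lower_tail t.
Proof.
move=> t0 /andP[pi0 pi1]; rewrite -prodr_const.
apply: le_trans (_ : \prod_(b | P b) smean q (fun S => 1 - contains R (F b) S) <= _).
  apply: ler_prod => b Pb.
  by rewrite smeanB smean_cst pr_F // subr_ge0 pi1 lexx.
have h := @harris_prod R U q q01 B P (fun b S => 1 - contains R (F b) S).
apply: le_trans (h _ _) _ => [b S|b S S' SS'|].
- by rewrite subr_ge0 contains_le1.
- by rewrite lerD2l lerN2 contains_increasing.
apply: ler_smean => // S.
have [/existsP[b /andP[Pb FS]]|/existsPn nF] := boolP [exists b, P b && (F b \subset S)].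
  by rewrite (bigD1 b) //= /contains FS subrr mul0r.
have -> : X S = 0.
  rewrite /wcount big1 ?mulr0 // => a _; rewrite /contains.
  case: (boolP (E a \subset S)) => // ES; have := nF (beta a).
  by rewrite Pbeta (subset_trans (Fbeta a)).
rewrite t0; apply: prodr_ile1 => b _.
by rewrite subr_ge0 contains_le1 lerBlDr lerDl contains_ge0.
Qed.

(** For [eps] above [(1 - p) / 16] the void event gives the constant 256; otherwise exponential
    tilting gives [512 * K]. *)
Lemma lower_tail_ge (eps p Phi K : R) :
  0 <= pi <= p -> p < 1 -> 0 <= eps <= 1 -> 0 <= K -> 0 <= Phi -> (0 < Phi -> 0 < nu) ->
  Phi = #|P|%:R * pi -> mu = Phi * nu ->
  overlap q E kappa * Phi <= K * mu ^+ 2 ->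
  (eps < 1)%R%:R <= eps ^+ 2 * Phi ->
  expR (- ((1 - p) ^- 5 * (256 + 512 * K) * eps ^+ 2 * Phi))
    <= lower_tail ((1 - eps) * mu).
Proof.
move=> /andP[pi0 pip] p1 /andP[eps0 eps1] K0 Phi0 nu_gt0 PhiE muE DPhi large.
have r0 : 0 < 1 - p by rewrite subr_gt0.
have r1 : 1 - p <= 1 by lra.
have pi01 : 0 <= pi <= 1 by lra.
have X0 : 0 <= mu by apply: smean_ge0 => // S; apply: wcount_ge0.
have inv_le m : (m <= 5)%N -> (1 - p) ^- m <= (1 - p) ^- 5.
  move=> m5; rewrite lef_pV2 ?posrE ?exprn_gt0 //.
  by apply: ler_wiXn2l => //; apply: ltW.
have eP0 : 0 <= eps ^+ 2 * Phi by rewrite mulr_ge0 ?sqr_ge0.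
rewrite -(mulrA _ (eps ^+ 2)) -(mulrA _ (256 + _)).
have [big|small] := ltP ((1 - p) / 16) eps.
  apply: le_trans (lower_tail_ge_void _ pi01); last by rewrite mulr_ge0 // subr_ge0.
  have pi1 : 0 <= pi < 1 by lra.
  apply: le_trans (_ : expR (- (pi / (1 - pi))) ^+ #|P| <= _); last first.
    by apply: lerXn2r; rewrite ?nnegrE ?expR_ge0 ?expR_geom_le // subr_ge0; lra.
  rewrite -expRM_natl ler_expR mulrN lerN2 [leLHS]mulrA -PhiE.
  apply: le_trans (_ : Phi / (1 - p) <= _).
    by rewrite ler_wpM2l // lef_pV2 ?posrE; lra.
  (* Here [1 - p < 16 * eps], so a factor $(1-p)^2$ is at most $256\varepsilon^2$. *)
  apply: le_trans (_ : (1 - p) ^- 3 * (256 * (eps ^+ 2 * Phi)) <= _).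
    have -> : Phi / (1 - p) = (1 - p) ^- 3 * ((1 - p) ^+ 2 * Phi).
      by field; rewrite gt_eqF.
    rewrite ler_wpM2l ?invr_ge0 ?exprn_ge0 ?(ltW r0) // [leRHS]mulrA ler_wpM2r //.
    have -> : 256 * eps ^+ 2 = (16 * eps) ^+ 2 by ring.
    rewrite ler_sqr ?nnegrE; lra.
  apply: ler_pM => //.
  - by rewrite invr_ge0 exprn_ge0 // ltW.
  - by rewrite mulr_ge0.
  - exact: inv_le.
  - by rewrite ler_wpM2r // lerDl mulr_ge0.
have epslt1 : eps < 1 by lra.
have {}large : 1 <= eps ^+ 2 * Phi by move: large; rewrite epslt1.
have Phi_gt0 : 0 < Phi.
  by rewrite lt_def Phi0 andbT; apply/eqP => Phi_0; move: large; rewrite Phi_0 mulr0 ler10.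
(* The factor 16 keeps [x <= 1] and makes [eps * x * Phi] equal to [w] below, half of the gain
   $(1-p)x^2\Phi/8$ that [bernoulli_laplace] guarantees. *)
pose x := 16 * eps / (1 - p).
have x01 : 0 <= x <= 1.
  rewrite divr_ge0 ?mulr_ge0 //= ?ler_pdivrMr //; lra.
have nu0 := nu_gt0 Phi_gt0.
pose s := x / nu; have s0 : 0 <= s by rewrite divr_ge0 ?(ltW nu0) //; lra.
have snu : s * nu = x by rewrite /s divfK // gt_eqF.
have smu : s * mu = x * Phi by rewrite muE mulrCA snu mulrC.
pose w := Phi * (1 - p) * x ^+ 2 / 16.
have epsE : eps = x * (1 - p) / 16 by rewrite /x; field; rewrite gt_eqF.
have w1 : 1 <= w.
  have -> : w = 16 * (eps ^+ 2 * Phi) / (1 - p) by rewrite /w /x; field; rewrite gt_eqF.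
  by rewrite ler_pdivlMr // mul1r; lra.
have ew : 1 + w <= expR w := expR_ge1Dx w.
have Ls : expR (- (x * Phi) + 2 * w) <= L s.
  apply: le_trans (laplace_ge s0); rewrite snu.
  apply: le_trans (lerXn2r _ _ _ (bernoulli_laplace pi01 x01)); last 2 first.
  - by rewrite nnegrE expR_ge0.
  - by rewrite nnegrE addr_ge0 ?mulr_ge0 ?expR_ge0 //; lra.
  rewrite -expRM_natl ler_expR.
  have -> : #|P|%:R * (- pi * x + pi * (1 - pi) * x ^+ 2 / 8) =
      - (x * Phi) + Phi * (1 - pi) * x ^+ 2 / 8 by rewrite PhiE; ring.
  rewrite lerD2l /w mulrA mulrC [leRHS]mulrC.
  have : Phi * (1 - p) * x ^+ 2 <= Phi * (1 - pi) * x ^+ 2.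
    by rewrite ler_wpM2r ?sqr_ge0 // ler_wpM2l //; lra.
  lra.
have L2s : L (2 * s) <= expR (- (2 * (x * Phi)) + 2 * (K * x ^+ 2 * Phi)).
  apply: le_trans (laplace_le q01 E kappa0 _) _; first by rewrite mulr_ge0.
  rewrite ler_expR.
  have -> : - (2 * s) * mu = - (2 * (x * Phi)) by rewrite -smu; ring.
  rewrite lerD2l.
  have -> : (2 * s) ^+ 2 * overlap q E kappa / 2 =
      2 * (s ^+ 2 / Phi * (overlap q E kappa * Phi)).
    by field; rewrite gt_eqF.
  have -> : K * x ^+ 2 * Phi = s ^+ 2 / Phi * (K * mu ^+ 2).
    have -> : s ^+ 2 / Phi * (K * mu ^+ 2) = K / Phi * (s * mu) ^+ 2.
      by field; rewrite gt_eqF.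
    by rewrite smu; field; rewrite gt_eqF.
  by rewrite ler_pM2l // ler_wpM2l // divr_ge0 ?sqr_ge0.
(* The level $(1-\varepsilon)\mu$ costs [w] while [L s] gains [2 * w], so the condition reduces to
   $2\le e^w$. *)
apply: le_trans (lower_tail_ge_laplace s0 _); last first.
  rewrite ler_pdivlMr //; apply: le_trans Ls.
  have -> : - s * ((1 - eps) * mu) = - (x * Phi) + w.
    have -> : - s * ((1 - eps) * mu) = - (s * mu) + eps * (s * mu) by ring.
    by rewrite smu {1}epsE /w; field.
  have -> : - (x * Phi) + 2 * w = - (x * Phi) + w + w by ring.
  by rewrite [leRHS]expRD ler_wpM2l ?expR_ge0 //; lra.
apply: le_trans (_ : expR (- (2 * (K * x ^+ 2 * Phi))) <= _).
  rewrite ler_expR lerN2.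
  have -> : 2 * (K * x ^+ 2 * Phi) = (1 - p) ^- 2 * (512 * K * (eps ^+ 2 * Phi)).
    by rewrite /x; field; rewrite gt_eqF.
  apply: ler_pM => //.
  - by rewrite invr_ge0 exprn_ge0 // ltW.
  - by rewrite !mulr_ge0.
  - exact: inv_le.
  - by rewrite ler_wpM2r // lerDr.
have L20 := laplace_gt0 q01 E kappa (2 * s).
rewrite ler_pdivlMr ?mulr_gt0 //.
apply: le_trans (ler_wpM2l (expR_ge0 _) (ler_wpM2l _ L2s)) _ => //.
(* The terms $2x\Phi$ cancel, and $e^{4w}\ge4$ absorbs the factor 4. *)
apply: le_trans (_ : expR (- (x * Phi) + 2 * w) ^+ 2 <= _); last first.
  by apply: lerXn2r; rewrite ?nnegrE ?expR_ge0 ?(ltW (laplace_gt0 _ _ _ _)).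
rewrite [leLHS]mulrCA -expRD [leRHS]expr2 -expRD.
have -> : - (x * Phi) + 2 * w + (- (x * Phi) + 2 * w) =
    - (2 * (x * Phi)) + w + w + 2 * w by ring.
have -> : - (2 * (K * x ^+ 2 * Phi)) + (- (2 * (x * Phi)) + 2 * (K * x ^+ 2 * Phi)) =
    - (2 * (x * Phi)) by ring.
rewrite [leRHS]expRD 2![in leRHS]expRD [leLHS]mulrC -2![leRHS]mulrA.
rewrite ler_wpM2l ?expR_ge0 //.
have e1 : 1 <= expR (2 * w) by apply: le_trans (expR_ge1Dx _); lra.
by nra.
Qed.

End Tails.

(** * Copies as orbits of the symmetric group *)

Definition gimage (T T' : finType) (f : T -> T') (x : {set T} * {set {set T}}) :
    {set T'} * {set {set T'}} :=
  (f @: x.1, [set f @: (e : {set T}) | e in x.2]).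

Lemma gimage_comp (T T' T'' : finType) (f : T -> T') (g : T' -> T'') x :
  gimage g (gimage f x) = gimage (g \o f) x.
Proof.
rewrite /gimage /= -!imset_comp; congr (_, _).
by apply: eq_imset => e /=; rewrite imset_comp.
Qed.

(** Vertices of [V] are treated one at a time, each corrected by a transposition. This replaces
    embeddings by permutations of the host vertices. *)
Lemma perm_extends (T T' : finType) (f g : T -> T') (V : {set T}) :
  injective f -> {in V &, injective g} ->
  exists s : {perm T'}, {in V, forall t, s (f t) = g t}.
Proof.
move=> fI gI.
suff [s sP] : exists s : {perm T'}, {in enum V, forall t, s (f t) = g t}.
  by exists s => t tV; apply: sP; rewrite mem_enum.
have : {subset enum V <= V} by move=> t; rewrite mem_enum.
elim: (enum V) (enum_uniq V) => [_ _|t r IHr /= /andP[tr ur] sub].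
  by exists 1%g.
have [s sP] : exists s : {perm T'}, {in r, forall t, s (f t) = g t}.
  by apply: IHr => // v vr; apply: sub; rewrite inE vr orbT.
(* Earlier values stay fixed: [g v] differs from [g t] by injectivity of [g], and from [s (f t)] by
   injectivity of [f] and [s]. *)
exists (s * tperm (s (f t)) (g t))%g => v; rewrite inE permM => /orP[/eqP->|vr].
  by rewrite tpermL.
have vt : v != t by apply: contraNneq tr => <-.
have vV : v \in V by apply: sub; rewrite inE vr orbT.
have tV : t \in V by apply: sub; rewrite inE eqxx.
rewrite tpermD ?(sP v) //; last by apply: contraNneq vt => /gI->.
by rewrite -(sP v vr) (inj_eq perm_inj) (inj_eq fI) eq_sym.
Qed.

Section Orbits.
Variables (n : nat) (T : finType) (iota : T -> 'I_n).
Hypothesis iota_inj : injective iota.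

Definition emb (s : {perm 'I_n}) (t : T) : 'I_n := s (iota t).

Definition gorbit x := [set gimage (emb s) x | s : {perm 'I_n}].

(** Order of the stabiliser of the base copy [gimage (emb 1) x]. *)
Definition gstab x : nat := #|[set s | gimage (emb s) x == gimage (emb 1) x]|.

Lemma emb_inj s : injective (emb s).
Proof. by move=> t t' /perm_inj /iota_inj. Qed.

Lemma gimage_embM s t x : gimage (emb (s * t)) x = gimage t (gimage (emb s) x).
Proof.
rewrite gimage_comp /gimage; congr (_, _); apply: eq_imset => v.
  by rewrite /= /emb permM.
by apply: eq_imset => w; rewrite /= /emb permM.
Qed.

Lemma gstab_gt0 x : (0 < gstab x)%N.
Proof. by apply/card_gt0P; exists 1%g; rewrite inE. Qed.

(** The fibre is the translate of the stabiliser by any one of its elements. *)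
Lemma card_gfiber x y : y \in gorbit x ->
  #|[set s | gimage (emb s) x == y]| = gstab x.
Proof.
case/imsetP => t _ ->; rewrite /gstab -[RHS](card_imset _ (mulIg t)).
apply: eq_card => s; apply/idP/imsetP => [|[r]]; rewrite !inE => /eqP sx.
  exists (s * t^-1)%g; last by rewrite mulgKV.
  by rewrite inE gimage_embM sx -gimage_embM mulgV.
by move=> ->; rewrite gimage_embM sx -gimage_embM mul1g.
Qed.

Lemma card_gfiber_le x y : (#|[set s | gimage (emb s) x == y]| <= gstab x)%N.
Proof.
have [yx|yx] := boolP (y \in gorbit x); first by rewrite card_gfiber.
rewrite (_ : [set s | _] = set0) ?cards0 //; apply/setP => s; rewrite !inE.
by apply: contraNF yx => /eqP <-; apply: imset_f.
Qed.

Lemma sum_gorbit (R : pzRingType) (g : {set 'I_n} * {set {set 'I_n}} -> R) x :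
  \sum_s g (gimage (emb s) x) = (gstab x)%:R * \sum_(y in gorbit x) g y.
Proof.
rewrite (partition_big (fun s => gimage (emb s) x) (mem (gorbit x))) /=; last first.
  by move=> s _; apply: imset_f.
rewrite mulr_sumr; apply: eq_bigr => y yx.
rewrite (eq_bigr (fun=> g y)) => [|s /eqP-> //].
rewrite sumr_const -(card_gfiber yx) mulr_natl; congr (_ *+ _).
by apply: eq_card => s; rewrite !inE.
Qed.

Lemma card_gorbit x : (#|gorbit x| * gstab x = n`!)%N.
Proof.
have := sum_gorbit (fun=> 1%:Z) x; rewrite !sumr_const card_Sn.
by rewrite -natrM mulnC => /eqP; rewrite eqr_nat => /eqP.
Qed.

Lemma gorbit_emb s x : gimage (emb s) x \in gorbit x.
Proof. exact: imset_f. Qed.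

Variable k : nat.

(** An isomorphism matters only on [vset J], where [perm_extends] matches it with a permutation;
    edges lie inside [vset J], so their images agree too. *)
Lemma isomorphic_gorbit (J : kgraph k T) (J' : kgraph k 'I_n) :
  isomorphic J J' = (kgraph_val J' \in gorbit (kgraph_val J)).
Proof.
apply/existsP/imsetP => [[f /and3P[/dinjectiveP fI /eqP fV /eqP fE]]|[s _ J'E]].
  have [s sP] := perm_extends iota_inj fI.
  exists s => //; case: J' fV fE => [[V' E'] J'P]; rewrite /vset /eset /= => <- <-.
  rewrite /gimage; congr (_, _); first by apply: eq_in_imset => t /sP.
  apply: eq_in_imset => e eJ; apply: eq_in_imset => t te; rewrite /emb sP //.
  have /forall_inP/(_ e eJ)/andP[/subsetP eV _] := kgraphP J.
  exact: eV.
exists [ffun t => emb s t]; apply/and3P; split.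
- by apply/dinjectiveP => t t' _ _; rewrite !ffunE => /emb_inj.
- apply/eqP; rewrite /vset J'E /=; apply: eq_imset => t; rewrite ffunE //.
- apply/eqP; rewrite /eset J'E /=; apply: eq_imset => e; apply: eq_imset => t; rewrite ffunE //.
Qed.

Lemma gorbit_kgraph (J : kgraph k T) y : y \in gorbit (kgraph_val J) -> is_kgraph k y.
Proof.
case/imsetP => s _ ->; apply/forall_inP => _ /imsetP[e eJ ->].
have /forall_inP/(_ e eJ)/andP[eV ek] := kgraphP J.
by rewrite imsetS //= card_imset //; apply: emb_inj.
Qed.

(** As [G] has all vertices, a copy lies in [G] exactly when its edges do. *)
Lemma copies_gorbit (R : realType) (J : kgraph k T) (G : kgraph k 'I_n) :
  vset G = setT ->
  (copies J G)%:R = \sum_(y in gorbit (kgraph_val J)) contains R y.2 (eset G).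
Proof.
move=> GT; rewrite /contains -natr_sum -big_mkcondr /= sum1_card; congr _%:R.
rewrite /copies -[LHS](card_imset _ val_inj); apply: eq_card => y.
apply/imsetP/idP => [[J']|].
  rewrite inE isomorphic_gorbit => /andP[/andP[_ sub] JJ'] ->.
  by rewrite unfold_in; apply/andP.
rewrite unfold_in => /andP[yJ sub]; exists (KGraph (gorbit_kgraph yJ)) => //.
by rewrite inE isomorphic_gorbit /= yJ andbT /subgraph GT subsetT.
Qed.

End Orbits.

(** * The random hypergraph as a random set of edges *)

Section RandomGraph.
Variables (R : realType) (k n : nat) (p : R).

(** Probability 0 for sets of the wrong size lets the ground set be all of [{set 'I_n}]. *)
Definition edge_prob (u : {set 'I_n}) : R := if #|u| == k then p else 0.

Lemma is_kgraph_full (S : {set {set 'I_n}}) :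
  is_kgraph k ([set: 'I_n], [set u in S | #|u| == k]).
Proof. by apply/forall_inP => u; rewrite inE => /andP[_ ->]; rewrite subsetT. Qed.

Lemma gnp_mean_smean (X : kgraph k 'I_n -> R) (f : {set {set 'I_n}} -> R) :
  (forall G, vset G = setT -> X G = f (eset G)) ->
  gnp_mean p X = smean edge_prob f.
Proof.
move=> Xf; pose full S := KGraph (is_kgraph_full S).
rewrite /gnp_mean (bigID (fun G : kgraph k 'I_n => vset G == setT)) /= addrC big1 ?add0r;
    last by move=> G /negbTE GT; rewrite /gnp_mass GT mul0r.
(* Graphs on all vertices correspond to sets of $k$-sets; a set with any other member has mass 0. *)
rewrite (reindex_onto full (@eset k 'I_n)) /=; last first.
  move=> G /eqP GT; apply: val_inj; rewrite /= -GT [RHS]surjective_pairing.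
  congr (_, _); apply/setP => u; rewrite inE; case: (boolP (u \in eset G)) => //= uG.
  by have /forall_inP/(_ u uG)/andP[_ ->] := kgraphP G.
rewrite /smean [RHS](bigID (fun S => eset (full S) == S)) /= [X in _ + X]big1 ?addr0; last first.
  move=> S; apply: contraNeq; rewrite mulf_eq0 negb_or => /andP[S0 _].
  apply/eqP/setP => u; rewrite inE; case: (boolP (u \in S)) => //= uS.
  move: S0; apply: contraNT => uk; rewrite /smass (bigD1 u) //= uS /edge_prob.
  by rewrite (negbTE uk) mul0r.
apply: eq_big => [S|S /andP[_ /eqP SE]]; first by rewrite eqxx.
rewrite Xf // SE; congr (_ * _).
rewrite /gnp_mass eqxx /smass SE [RHS](bigID (fun u : {set 'I_n} => #|u| == k)) /=.
rewrite [X in _ * X]big1 ?mulr1; last first.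
  move=> u /negbTE uk; rewrite /edge_prob uk subr0; case: ifP => //.
  by rewrite -SE inE uk andbF.
by apply: eq_bigr => u uk; rewrite /edge_prob uk.
Qed.

Lemma gnp_prob_smean (A : pred (kgraph k 'I_n)) (a : pred {set {set 'I_n}}) :
  (forall G, vset G = setT -> A G = a (eset G)) ->
  gnp_prob p A = smean edge_prob (fun S => (a S)%:R).
Proof.
move=> Aa; rewrite -(gnp_mean_smean (X := fun G => (A G)%:R)).
  rewrite /gnp_prob /gnp_mean big_mkcond; apply: eq_bigr => G _.
  by case: (A G); rewrite ?mulr1 ?mulr0.
by move=> G GT; rewrite Aa.
Qed.

End RandomGraph.

(** * Copy counts and overlapping pairs of copies *)

Lemma gimage_cover (T T' : finType) (f : T -> T') (F : {set {set T}}) :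
  gimage f (cover F, F) =
  (cover [set f @: (e : {set T}) | e in F], [set f @: (e : {set T}) | e in F]).
Proof.
by rewrite /gimage /= cover_imset imset_cover.
Qed.

(** Without isolated vertices, the image of a graph is determined by the images of its edges. *)
Lemma is_kgraph_cover (k : nat) (T : finType) (H : kgraph k T) (F : {set {set T}}) :
  F \subset eset H -> is_kgraph k (cover F, F).
Proof.
move=> /subsetP FH; apply/forall_inP => e eF /=.
have /forall_inP/(_ e (FH e eF))/andP[_ ->] := kgraphP H.
by rewrite andbT; apply: bigcup_sup.
Qed.

Lemma subgraph_cover (k : nat) (T : finType) (H : kgraph k T) (F : {set {set T}})
  (FH : F \subset eset H) : subgraph (KGraph (is_kgraph_cover FH)) H.
Proof.
rewrite /subgraph /vset /eset /= FH andbT; apply/bigcupsP => e eF.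
by have /forall_inP/(_ e (subsetP FH e eF))/andP[] := kgraphP H.
Qed.

Section SubgraphCounts.
Variables (R : realType) (k n : nat) (p : R).
Hypothesis p01 : 0 <= p <= 1.
Variables (T : finType) (iota : T -> 'I_n).
Hypothesis iota_inj : injective iota.
Local Notation q := (@edge_prob R k n p).
Local Notation orbit J := (gorbit iota (kgraph_val J)).
Local Notation stab J := (gstab iota (kgraph_val J)).

Lemma edge_prob01 u : 0 <= q u <= 1.
Proof. by rewrite /edge_prob; case: ifP; rewrite ?lexx ?ler01. Qed.

Lemma smean_contains_kedges (F : {set {set 'I_n}}) :
  {in F, forall u : {set _}, #|u| = k} -> smean q (contains R F) = p ^+ #|F|.
Proof.
move=> Fk; rewrite smean_contains -prodr_const; apply: eq_bigr => u /Fk uk.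
by rewrite /edge_prob uk eqxx.
Qed.

Lemma gorbit_kedges (J : kgraph k T) y : y \in orbit J -> {in y.2, forall u : {set _}, #|u| = k}.
Proof. by move=> /(gorbit_kgraph iota_inj)/forall_inP yk u /yk/andP[_ /eqP]. Qed.

Lemma card_gorbit_edges (J : kgraph k T) y : y \in orbit J -> #|y.2| = #|eset J|.
Proof.
by case/imsetP => s _ ->; rewrite card_imset //; apply/imset_inj/emb_inj.
Qed.

Lemma smean_contains_gorbit (J : kgraph k T) y : y \in orbit J ->
  smean q (contains R y.2) = p ^+ #|eset J|.
Proof.
by move=> yJ; rewrite smean_contains_kedges ?(card_gorbit_edges yJ) //; apply: gorbit_kedges yJ.
Qed.

Lemma gnp_mean_copies (J : kgraph k T) :
  gnp_mean p (X_ R n J) = #|orbit J|%:R * p ^+ #|eset J|.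
Proof.
rewrite (gnp_mean_smean p (f := fun S => \sum_(y in orbit J) contains R y.2 S)); last first.
  by move=> G GT; apply: copies_gorbit.
rewrite smean_sum (eq_bigr (fun=> p ^+ #|eset J|)) => [|y /smean_contains_gorbit //].
by rewrite sumr_const mulr_natl.
Qed.

Variable H : kgraph k T.

(** Indexing by permutations lists each copy of [H] exactly [stab H] times, which the weight [kappa]
    undoes. *)
Definition copy_edges (s : {perm 'I_n}) : {set {set 'I_n}} :=
  (gimage (emb iota s) (kgraph_val H)).2.

Local Notation kappa := ((stab H)%:R^-1 : R).
Local Notation e := #|eset H|.

Lemma copies_wcount (G : kgraph k 'I_n) : vset G = setT ->
  X_ R n H G = wcount copy_edges kappa (eset G).
Proof.
move=> GT; rewrite /X_ (copies_gorbit iota_inj R) // /wcount.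
rewrite (sum_gorbit iota (fun y => contains R y.2 (eset G))) mulKf //.
by rewrite pnatr_eq0 -lt0n gstab_gt0.
Qed.

(** Pulls the common edges of two copies back along [s] to a set of edges of [H]. *)
Lemma copy_edges_common s t :
  let common s t := [set a in eset H | emb iota s @: (a : {set T}) \in copy_edges t] in
  [set emb iota s @: (a : {set T}) | a in common s t] = copy_edges s :&: copy_edges t.
Proof.
move=> common; apply/setP => u; rewrite inE.
apply/imsetP/andP => [[a]|[/imsetP[a aH ->] at_]].
  by rewrite inE => /andP[aH at_] ->; rewrite at_ (imset_f (fun a : {set T} => emb iota s @: a)).
by exists a => //; rewrite inE aH.
Qed.

Lemma card_copy_edges s : #|copy_edges s| = e.
Proof. exact/card_gorbit_edges/gorbit_emb. Qed.

Lemma smean_union s t : 0 < p ->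
  smean q (contains R (copy_edges s :|: copy_edges t)) =
  p ^+ (2 * e) / p ^+ #|copy_edges s :&: copy_edges t|.
Proof.
move=> p0; rewrite smean_contains_kedges; last first.
  by move=> u /setUP[]; apply: gorbit_kedges; apply: (gorbit_emb iota _ (kgraph_val H)).
have := cardsUI (copy_edges s) (copy_edges t); rewrite !card_copy_edges addnn -mul2n => <-.
by rewrite exprD mulfK // expf_neq0 // gt_eqF.
Qed.

(** With [J] spanned by [F], orbit counting turns the bound $n!\,|\mathrm{Stab}|\,p^{2e-|F|}$ for
    the pairs charged to [F] and [F'] into $(n!)^2p^{2e}/\mathbb E X_J$, and $\Phi\le\mathbb E X_J$.
    The factor $4^e$ bounds the number of choices of [F] and [F']. *)
Lemma overlap_le (Phi : R) : 0 <= Phi -> (p = 0 -> Phi = 0) ->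
  (forall J : kgraph k T, subgraph J H -> (1 <= #|eset J|)%N ->
     Phi <= gnp_mean p (X_ R n J)) ->
  overlap q copy_edges kappa * Phi <= 4 ^+ e * gnp_mean p (X_ R n H) ^+ 2.
Proof.
move=> Phi0 pPhi Phi_le; have /andP[p_ge0 _] := p01.
have [p0|p_le0] := ltP 0 p; last first.
  have -> : Phi = 0 by apply: pPhi; apply/eqP; rewrite eq_le p_le0.
  by rewrite mulr0 mulr_ge0 ?sqr_ge0 ?exprn_ge0.
have stab_neq0 (J : kgraph k T) : (stab J)%:R != 0 :> R by rewrite pnatr_eq0 -lt0n gstab_gt0.
have muE : gnp_mean p (X_ R n H) = kappa * (n`!%:R * p ^+ e).
  rewrite gnp_mean_copies -(card_gorbit iota (kgraph_val H)) natrM.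
  move: (stab_neq0 H); move: ((stab H)%:R : R) (#|orbit H|%:R : R) (p ^+ e) => a b c a0.
  by field.
pose img s (F : {set {set T}}) := [set emb iota s @: (a : {set T}) | a in F].
pose sub : pred {set {set T}} := [pred F : {set {set T}} | (F \subset eset H) && (F != set0)].
(* a pair of intersecting copies is charged to the preimages F, F' of their
   common edges; for given F, F' there are at most n! |Stab F| such pairs *)
have term s t : ~~ [disjoint copy_edges s & copy_edges t] ->
    smean q (contains R (copy_edges s :|: copy_edges t)) <=
    \sum_(F | sub F) \sum_(F' | sub F')
      (img s F == img t F')%:R * (p ^+ (2 * e) / p ^+ #|F|).
  move=> st; pose common s t := [set a in eset H | emb iota s @: (a : {set T}) \in copy_edges t].
  have imgE s' t' : img s' (common s' t') = copy_edges s' :&: copy_edges t'.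
    exact: copy_edges_common.
  have sub_common s' t' : ~~ [disjoint copy_edges s' & copy_edges t'] -> sub (common s' t').
    rewrite -setI_eq0 -imgE /= => ne; apply/andP; split.
      by apply/subsetP => a; rewrite inE => /andP[].
    by apply: contraNneq ne => ->; rewrite /img imset0.
  (* The summand at these two preimages is already the left side; the others are nonnegative. *)
  rewrite (bigD1 (common s t)) ?sub_common //= (bigD1 (common t s)) /=; last first.
    by apply: sub_common; rewrite disjoint_sym.
  rewrite !imgE setIC eqxx mul1r -addrA ler_wpDr //.
    by apply: addr_ge0; apply: sumr_ge0 => F _; [|apply: sumr_ge0 => F2 _];
      by rewrite mulr_ge0 ?divr_ge0 ?exprn_ge0.
  rewrite smean_union // -[X in _ / _ ^+ X <= _](_ : #|common s t| = _) //.
  rewrite -imgE card_imset //; exact/imset_inj/emb_inj.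
have pairs F F' : sub F ->
    Phi * \sum_s \sum_t (img s F == img t F')%:R * (p ^+ (2 * e) / p ^+ #|F|)
    <= n`!%:R ^+ 2 * p ^+ (2 * e).
  move=> /andP[FH F0]; set J := KGraph (is_kgraph_cover FH).
  have PhiJ : Phi <= gnp_mean p (X_ R n J).
    by apply: Phi_le; [apply: subgraph_cover | rewrite card_gt0].
  rewrite exchange_big /=.
  apply: (@le_trans _ _ (Phi * (n`!%:R * ((stab J)%:R * (p ^+ (2 * e) / p ^+ #|F|))))).
    rewrite ler_wpM2l // -(card_Sn n) mulr_natl -sumr_const; apply: ler_sum => t _.
    rewrite -mulr_suml ler_wpM2r ?divr_ge0 ?exprn_ge0 //.
    rewrite -natr_sum ler_nat -big_mkcond /= sum1_card.
    (* For fixed [t] the admissible [s] lie in one fibre, because equal edge images have equal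
       covers. *)
    apply: leq_trans (card_gfiber_le iota (kgraph_val J) (gimage (emb iota t) (cover F', F'))).
    apply: subset_leq_card; apply/subsetP => s; move=> stF.
    have {stF}/eqP stF : img s F == img t F' := stF.
    by rewrite inE !gimage_cover -/(img s F) -/(img t F') stF.
  have -> : Phi * (n`!%:R * ((stab J)%:R * (p ^+ (2 * e) / p ^+ #|F|))) =
      n`!%:R * (stab J)%:R * (p ^+ (2 * e) / p ^+ #|F|) * Phi by rewrite [RHS]mulrC -!mulrA.
  apply: le_trans (ler_wpM2l _ PhiJ) _.
    by rewrite !mulr_ge0 ?ler0n ?invr_ge0 ?exprn_ge0.
  rewrite gnp_mean_copies -(card_gorbit iota (kgraph_val J)) natrM /eset /=.
  have pF : p ^+ #|F| != 0 by rewrite expf_neq0 // gt_eqF.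
  move: (p ^+ #|F|) (p ^+ (2 * e)) (#|gorbit _ _|%:R : R) ((gstab _ _)%:R : R) pF.
  by move=> a b c d a0; rewrite le_eqVlt; apply/orP; left; apply/eqP; field.
rewrite muE /overlap.
have -> : 4 ^+ e * (kappa * (n`!%:R * p ^+ e)) ^+ 2 =
    kappa ^+ 2 * (4 ^+ e * (n`!%:R ^+ 2 * p ^+ (2 * e))).
  rewrite [(2 * e)%N]mulnC exprM; move: kappa (4 ^+ e : R) (n`!%:R : R) (p ^+ e) => a b c d.
  by ring.
rewrite -mulrA ler_wpM2l ?sqr_ge0 // mulrC.
apply: (@le_trans _ _ (\sum_(F | sub F) \sum_(F' | sub F')
    Phi * \sum_s \sum_t (img s F == img t F')%:R * (p ^+ (2 * e) / p ^+ #|F|))).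
  rewrite -[leRHS](_ : Phi * \sum_s \sum_t \sum_(F | sub F) \sum_(F' | sub F')
      (img s F == img t F')%:R * (p ^+ (2 * e) / p ^+ #|F|) = _); last first.
    under [RHS]eq_bigr do rewrite -mulr_sumr.
    rewrite -mulr_sumr; congr (_ * _).
    under eq_bigr do rewrite exchange_big /=.
    rewrite exchange_big /=; apply: eq_bigr => F _.
    under eq_bigr do rewrite exchange_big /=.
    by rewrite exchange_big.
  rewrite ler_wpM2l //; apply: ler_sum => s _.
  rewrite big_mkcond; apply: ler_sum => t _; case: ifP => [st|_]; first exact: term.
  by do 2 (apply: sumr_ge0 => ? _); rewrite mulr_ge0 ?divr_ge0 ?exprn_ge0.
apply: (@le_trans _ _ (\sum_(F | sub F) \sum_(F' | sub F') n`!%:R ^+ 2 * p ^+ (2 * e))).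
  by apply: ler_sum => F subF; apply: ler_sum => F' _; apply: pairs.
have cardsub : (#|sub| <= 2 ^ e)%N.
  rewrite -card_powerset; apply: subset_leq_card; apply/subsetP => F.
  by rewrite !inE => /andP[].
rewrite !sumr_const -mulrnA -[leLHS]mulr_natl.
rewrite ler_wpM2r ?mulr_ge0 ?sqr_ge0 ?exprn_ge0 //.
rewrite -natrX ler_nat (_ : 4 = 2 * 2)%N // expnMn.
exact: leq_mul.
Qed.

End SubgraphCounts.

(** * The minimising subgraph and the choice of constants *)

Lemma Phi_min (R : realType) (k n : nat) (p : R) (T : finType) (H : kgraph k T) :
  (1 <= #|eset H|)%N ->
  (exists J : kgraph k T, [/\ subgraph J H, (1 <= #|eset J|)%N &
     Phi n p H = gnp_mean p (X_ R n J)]) /\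
  (forall J : kgraph k T, subgraph J H -> (1 <= #|eset J|)%N ->
     Phi n p H <= gnp_mean p (X_ R n J)).
Proof.
move=> eH; split; last first.
  by move=> J JH eJ; apply: bigmin_le_cond; rewrite JH.
(* Applied to [Phi <= Phi], this returns an attaining term: the default, at [H] itself, or an
   admissible [J]. *)
have [/boolp.bigmin_leP h] : Phi n p H <= Phi n p H by [].
have HH : subgraph H H by rewrite /subgraph !subxx.
case: (h) => [HPhi|[J /andP[JH eJ] JPhi]].
  exists H; split => //; apply/eqP; rewrite eq_le HPhi andbT.
  by apply: bigmin_le_cond; rewrite HH.
exists J; split => //; apply/eqP; rewrite eq_le JPhi andbT.
by apply: bigmin_le_cond; rewrite JH.
Qed.

Theorem theorem3 (R : realType) (k : nat) (hk : (2 <= k)%N)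
    (T : finType) (H : kgraph k T) (hH : (1 <= #|eset H|)%N) :
  exists (c C D : R) (n0 : nat),
    [/\ 0 < c, 0 < C, 0 < D & (0 < n0)%N] /\
    forall (n : nat) (p eps : R),
      (n0 <= n)%N -> 0 <= p < 1 -> 0 <= eps <= 1 ->
      (eps < 1)%R%:R * D <= eps ^+ 2 * Phi n p H ->
      expR (- ((1 - p) ^- 5 * C * eps ^+ 2 * Phi n p H))
        <= gnp_prob p (fun G : kgraph k 'I_n =>
             X_ R n H G <= (1 - eps) * gnp_mean p (X_ R n H))
        <= expR (- (c * eps ^+ 2 * Phi n p H)).
Proof.
set K : R := 4 ^+ #|eset H|.
have K0 : 0 < K by rewrite exprn_gt0.
(* The first two constants come from [lower_tail_le] and [lower_tail_ge], with [K] bounding the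
   overlap; [n >= #|T|.+1] lets [T] embed into ['I_n]. *)
exists (2 * K)^-1, (256 + 512 * K), 1, #|T|.+1; split.
  by split; rewrite ?invr_gt0 ?mulr_gt0 ?addr_gt0 // mulr_gt0.
move=> n p eps Tn /andP[p0 p1] eps01 large; rewrite mulr1 in large.
have p01 : 0 <= p <= 1 by rewrite p0 ltW.
pose iota t : 'I_n := widen_ord (ltnW Tn) (enum_rank t).
have iota_inj : injective iota.
  by move=> t t' /(congr1 val) /= /val_inj /enum_rank_inj.
have [[J [JH eJ PhiJ]] Phi_le] := Phi_min n p hH.
have meanE (J' : kgraph k T) := gnp_mean_copies p iota_inj J'.
set N := fun J' : kgraph k T => #|gorbit iota (kgraph_val J')|.
set st := fun J' : kgraph k T => gstab iota (kgraph_val J').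
have Nst J' : (N J' * st J' = n`!)%N := card_gorbit iota (kgraph_val J').
have N0 J' : (0 < N J')%N.
  by have := fact_gt0 n; rewrite -(Nst J') muln_gt0 => /andP[].
have st0 J' : (0 < st J')%N := gstab_gt0 iota _.
pose kappa : R := (st H)%:R^-1; have kappa0 : 0 <= kappa by rewrite invr_ge0 ler0n.
pose q := @edge_prob R k n p; have q01 := @edge_prob01 R k n p p01.
pose E := copy_edges iota H.
have mu : gnp_mean p (X_ R n H) = smean q (wcount E kappa).
  by apply: gnp_mean_smean => G GT; apply: copies_wcount iota_inj _ _ GT.
have -> : gnp_prob p (fun G : kgraph k 'I_n =>
     X_ R n H G <= (1 - eps) * gnp_mean p (X_ R n H)) =
     lower_tail q E kappa ((1 - eps) * smean q (wcount E kappa)).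
  by rewrite mu; apply: gnp_prob_smean => G GT; rewrite (copies_wcount R iota_inj).
have Phi0 : 0 <= Phi n p H by rewrite PhiJ meanE mulr_ge0 ?exprn_ge0.
have Phi_p0 : p = 0 -> Phi n p H = 0.
  by move=> pz; rewrite PhiJ meanE pz expr0n (gtn_eqF eJ) mulr0.
have ov : overlap q E kappa * Phi n p H <= K * smean q (wcount E kappa) ^+ 2.
  by rewrite -mu; apply: overlap_le.
have eJH : (#|eset J| <= #|eset H|)%N.
  by apply: subset_leq_card; case/andP: JH.
apply/andP; split; last first.
  (* At [p = 0] the mean vanishes and [lower_tail_le] does not apply, but then [Phi] is 0 and the
     claimed bound is 1. *)
  have [p_gt0|p_le0] := ltP 0 p; last first.
    rewrite (Phi_p0 _) ?mulr0 ?oppr0 ?expR0 ?lower_tail_le1 //.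
    by apply/eqP; rewrite eq_le p_le0.
  rewrite [X in expR (- X)](_ : _ = eps ^+ 2 * Phi n p H / (2 * K)); last first.
    by rewrite -mulrA mulrC.
  apply: lower_tail_le => //; first by case/andP: eps01.
  by rewrite -mu meanE mulr_gt0 ?exprn_gt0 // ltr0n N0.
(* Exactly [st J] permutations send [J] to a given copy, each has weight [1 / st H], and the
   remaining $e_H-e_J$ edges are present with probability $p$ each. *)
pose nu : R := (st J)%:R / (st H)%:R * p ^+ (#|eset H| - #|eset J|).
(* Each permutation assigns its copy of [H] to the image of [J] inside it, so all pieces have the
   same mean. *)
apply: (@lower_tail_ge _ _ q q01 _ E kappa kappa0 _ (mem (gorbit iota (kgraph_val J))) snd
   (fun s => gimage (emb iota s) (kgraph_val J)) (p ^+ #|eset J|) nu) => //.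
- by move=> s; apply: gorbit_emb.
- by move=> s; apply: imsetS; case/andP: JH.
- by move=> y yJ; apply: (smean_contains_gorbit p iota_inj yJ).
- move=> y yJ.
  rewrite (eq_bigr (fun=> p ^+ #|eset H|)); last first.
    by move=> s _; apply: (smean_contains_gorbit p iota_inj (gorbit_emb _ _ _)).
  rewrite sumr_const.
  rewrite [X in _ *+ X](_ : _ = st J); last first.
    by rewrite /st -(card_gfiber yJ); apply: eq_card => s; rewrite !inE.
  rewrite -mulr_natl -{1}(subnK eJH) exprD /nu /kappa.
  move: ((st H)%:R^-1 : R) ((st J)%:R : R) (p ^+ #|eset J|) (p ^+ (_ - _)) => a b c d.
  by ring.
- by rewrite exprn_ge0 //= -[leRHS]expr1; apply: ler_wiXn2l => //; apply: ltW.
- exact: ltW.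
- move=> Phi_gt0; have p_gt0 : 0 < p.
    by rewrite lt_def p0 andbT; apply: contraTneq Phi_gt0 => /Phi_p0->; rewrite ltxx.
  by rewrite mulr_gt0 ?exprn_gt0 // divr_gt0 // ltr0n st0.
- by rewrite PhiJ meanE.
- rewrite -mu PhiJ !meanE /nu.
  (* Both products are [n!]; this identifies the mean of [X_H] with [Phi * nu]. *)
  have : (N J)%:R * (st J)%:R = (N H)%:R * (st H)%:R :> R by rewrite -!natrM !Nst.
  rewrite -/(N H) -/(N J) -{1}(subnK eJH) exprD => NE.
  have stH : (st H)%:R != 0 :> R by rewrite pnatr_eq0 -lt0n st0.
  apply: (mulIf stH); rewrite mulrAC -NE; move: stH.
  move: ((st H)%:R : R) ((st J)%:R : R) ((N J)%:R : R) (p ^+ #|eset J|) (p ^+ (_ - _)).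
  by move=> a b c d d' a0; field.
Qed.
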